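(* Let $\mathbb{A}$ be a set of generators, let $S,T,U$ be $\mathbb{A}$-shapes, and let $f:S\to T$ and $g:T\to U$ be $\mathbb{A}$-linkings. Then the path composite $f;g:S\to U$ is an $\mathbb{A}$-linking.
   Context: Let $\mathbb{A}$ be a set, whose elements are called generators. An atom is a generator or the constant $I$. An $\mathbb{A}$-shape is an expression generated from atoms by binary $\otimes$ and unary dual $(-)^*$; it is identified with its parse tree (leaves labelled by atoms, internal vertices labelled $\otimes$ or $*$; argument edges join a vertex to its arguments). An occurrence of an atom or of $\otimes$ in a shape is positive if it lies under an even number of duals, otherwise negative. $|S|^+$, $|S|^-$ denote the sets of positive and negative leaves of $S$, and $+$ denotes disjoint union. A leaf function $f:S\to T$ is a total function from $|S|^++|T|^-$ to $|S|^-+|T|^+$, viewed as a set of directed edges $l\to f(l)$. The graph of $f$ is the disjoint union of the parse trees of $S$ and $T$ together with the edges of $f$, undirected. A switching of $f$ is a subgraph of the graph of $f$ obtained by deleting exactly one of the two argument edges of each positive $\otimes$ of $S$ and of each negative $\otimes$ of $T$. An $\mathbb{A}$-linking is a leaf function $f:S\to T$ such that (1) for each generator $a$, $f$ restricts to a bijection from the $a$-labelled leaves in $|S|^++|T|^-$ to the $a$-labelled leaves in $|S|^-+|T|^+$; and (2) every switching of $f$ is a tree. Path composite: for $f:S\to T$ and $g:T\to U$, $f;g$ is the partial function from $|S|^++|U|^-$ to $|S|^-+|U|^+$ with $(f;g)(l)=l'$ iff there is a finite directed path from $l$ to $l'$ in the union of the edges of $f$ and of $g$, a directed graph on the disjoint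 union of the leaves of $S$, $T$ and $U$. (In particular the assertion includes that $f;g$ is total.) *)

(* Defs.v *)
From mathcomp Require Import all_boot.
From mathcomp Require Import boolp classical_sets functions.

Set Implicit Arguments.
Unset Strict Implicit.
Unset Printing Implicit Defensive.

Inductive atom (A : Type) : Type := Gen of A | UnitI.
Arguments UnitI {A}.

Inductive star_shape (A : Type) : Type :=
| Atom of atom A
| Tensor of star_shape A & star_shape A
| Dual of star_shape A.

Inductive vertex_label (A : Type) : Type :=
| LAtom of atom A | LTensor | LDual.
Arguments LTensor {A}.
Arguments LDual {A}.

(* Vertices of the parse tree, i.e. occurrences of subexpressions; in a compound
   shape [None] is the root, and [Some] addresses the argument(s). *)
Fixpoint vertex (A : Type) (S : star_shape A) : finType :=
  match S with
  | Atom _ => unit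
  | Tensor S1 S2 => option (vertex S1 + vertex S2)
  | Dual S1 => option (vertex S1)
  end.

Definition shape_root (A : Type) (S : star_shape A) : vertex S :=
  match S return vertex S with
  | Atom _ => tt
  | Tensor _ _ => None
  | Dual _ => None
  end.
Arguments shape_root {A} S.

Fixpoint label (A : Type) (S : star_shape A) : vertex S -> vertex_label A :=
  match S return vertex S -> vertex_label A with
  | Atom a => fun _ => LAtom a
  | Tensor S1 S2 => fun v => match v with
      | None => LTensor
      | Some (inl v1) => label v1
      | Some (inr v2) => label v2
      end
  | Dual S1 => fun v => if v is Some v1 then label v1 else LDual
  end.

(* [is_positive v]: v lies under an even number of duals; the root of [Dual S1] does
   not itself lie under that dual. *)
Fixpoint is_positive (A : Type) (S : star_shape A) : vertex S -> bool :=
  match S return vertex S -> bool with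
  | Atom _ => fun _ => true
  | Tensor S1 S2 => fun v => match v with
      | None => true
      | Some (inl v1) => is_positive v1
      | Some (inr v2) => is_positive v2
      end
  | Dual S1 => fun v => if v is Some v1 then ~~ is_positive v1 else true
  end.

(* [argument_edge i u v]: v is the root of an argument of u, with [i] telling which:
   [false] for the left argument of a tensor and for the argument of a dual,
   [true] for the right argument of a tensor. *)
Fixpoint argument_edge (A : Type) (S : star_shape A) (i : bool) :
    vertex S -> vertex S -> bool :=
  match S return vertex S -> vertex S -> bool with
  | Atom _ => fun _ _ => false
  | Tensor S1 S2 => fun u v => match u, v with
      | None, Some (inl v1) => ~~ i && (v1 == shape_root S1)
      | None, Some (inr v2) => i && (v2 == shape_root S2)
      | Some (inl u1), Some (inl v1) => argument_edge i u1 v1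
      | Some (inr u2), Some (inr v2) => argument_edge i u2 v2
      | _, _ => false
      end
  | Dual S1 => fun u v => match u, v with
      | None, Some v1 => ~~ i && (v1 == shape_root S1)
      | Some u1, Some v1 => argument_edge i u1 v1
      | _, _ => false
      end
  end.

Definition is_leaf (A : Type) (S : star_shape A) (v : vertex S) : bool :=
  if label v is LAtom _ then true else false.

Definition is_tensor (A : Type) (S : star_shape A) (v : vertex S) : bool :=
  if label v is LTensor then true else false.

Definition leaf (A : Type) (S : star_shape A) : finType :=
  {v : vertex S | is_leaf v}.
Definition pos_leaf (A : Type) (S : star_shape A) : finType :=
  {l : leaf S | is_positive (val l)}.
Definition neg_leaf (A : Type) (S : star_shape A) : finType :=
  {l : leaf S | ~~ is_positive (val l)}.

Definition leaf_dom (A : Type) (S T : star_shape A) : finType :=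
  (pos_leaf S + neg_leaf T)%type.
Definition leaf_cod (A : Type) (S T : star_shape A) : finType :=
  (neg_leaf S + pos_leaf T)%type.

Definition leaf_function (A : Type) (S T : star_shape A) : Type :=
  leaf_dom S T -> leaf_cod S T.

Definition dom_leaf (A : Type) (S T : star_shape A) (l : leaf_dom S T) :
    (leaf S + leaf T)%type :=
  match l with inl p => inl (val p) | inr n => inr (val n) end.
Definition cod_leaf (A : Type) (S T : star_shape A) (l : leaf_cod S T) :
    (leaf S + leaf T)%type :=
  match l with inl n => inl (val n) | inr p => inr (val p) end.

Definition has_atom (A : Type) (S T : star_shape A) (x : atom A)
    (l : (leaf S + leaf T)%type) : Prop :=
  match l with
  | inl s => label (val s) = LAtom x
  | inr t => label (val t) = LAtom x
  end.

Definition graph_vertex (A : Type) (S T : star_shape A) : finType :=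
  (vertex S + vertex T)%type.

Definition leaf_vertex (A : Type) (S T : star_shape A) (l : (leaf S + leaf T)%type) :
    graph_vertex S T :=
  match l with inl s => inl (val s) | inr t => inr (val t) end.

Definition graph_argument_edge (A : Type) (S T : star_shape A) (i : bool)
    (x y : graph_vertex S T) : bool :=
  match x, y with
  | inl u, inl v => argument_edge i u v
  | inr u, inr v => argument_edge i u v
  | _, _ => false
  end.

Definition graph_leaf_edge (A : Type) (S T : star_shape A) (f : leaf_function S T)
    (x y : graph_vertex S T) : bool :=
  [exists l : leaf_dom S T,
     (x == leaf_vertex (dom_leaf l)) && (y == leaf_vertex (cod_leaf (f l)))].

Definition switched (A : Type) (S T : star_shape A) (x : graph_vertex S T) : bool :=
  match x with
  | inl u => is_tensor u && is_positive u
  | inr v => is_tensor v && ~~ is_positive v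
  end.

(* A switching is given by a choice [sw] of the argument edge to delete at each
   switched tensor; the values of [sw] at the other vertices are irrelevant. *)
Definition switching (A : Type) (S T : star_shape A) (f : leaf_function S T)
    (sw : graph_vertex S T -> bool) : rel (graph_vertex S T) :=
  let kept x y := [exists i : bool,
    graph_argument_edge i x y && ~~ (switched x && (sw x == i))] in
  fun x y => [|| kept x y, kept y x, graph_leaf_edge f x y | graph_leaf_edge f y x].

(* For the adjacency relation [e] of a nonempty simple undirected graph: connected,
   without simple cycles. The bound 2 discards back-and-forth walks along an edge. *)
Definition is_tree (V : finType) (e : rel V) : Prop :=
  (forall x y : V, connect e x y) /\
  (forall c : seq V, ucycle e c -> size c <= 2).

Definition is_linking (A : Type) (S T : star_shape A) (f : leaf_function S T) : Prop :=
  (forall a : A,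
     set_bij [set l : leaf_dom S T | has_atom (Gen a) (dom_leaf l)]%classic
             [set l : leaf_cod S T | has_atom (Gen a) (cod_leaf l)]%classic f) /\
  (forall sw : graph_vertex S T -> bool, is_tree (switching f sw)).

Definition leaf3 (A : Type) (S T U : star_shape A) : finType :=
  (leaf S + leaf T + leaf U)%type.

Definition in_ST (A : Type) (S T U : star_shape A) (l : (leaf S + leaf T)%type) :
    leaf3 S T U := inl l.
Definition in_TU (A : Type) (S T U : star_shape A) (l : (leaf T + leaf U)%type) :
    leaf3 S T U := match l with inl t => inl (inr t) | inr u => inr u end.
Definition in_SU (A : Type) (S T U : star_shape A) (l : (leaf S + leaf U)%type) :
    leaf3 S T U := match l with inl s => inl (inl s) | inr u => inr u end.

Definition union_edge (A : Type) (S T U : star_shape A)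
    (f : leaf_function S T) (g : leaf_function T U) : rel (leaf3 S T U) :=
  fun x y =>
    [exists l : leaf_dom S T,
       (x == in_ST U (dom_leaf l)) && (y == in_ST U (cod_leaf (f l)))]
    || [exists l : leaf_dom T U,
       (x == in_TU S (dom_leaf l)) && (y == in_TU S (cod_leaf (g l)))].

(* The path composite, as the graph of a partial function:
   [path_composite f g l l'] says that (f;g)(l) is defined and equal to l'. *)
Definition path_composite (A : Type) (S T U : star_shape A)
    (f : leaf_function S T) (g : leaf_function T U)
    (l : leaf_dom S U) (l' : leaf_cod S U) : Prop :=
  connect (union_edge f g) (in_SU T (dom_leaf l)) (in_SU T (cod_leaf l')).

(* Main.v *)
Require Import Defs.
From mathcomp Require Import all_boot.
From mathcomp Require Import boolp classical_sets functions.

Set Implicit Arguments.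
Unset Strict Implicit.
Unset Printing Implicit Defensive.

(** Glue the graphs of f and g along the leaves of T, dropping the inner vertices of T.
    The result is a tree (for each switching of S and U) by induction on T: this is cut
    elimination for the Danos-Regnier criterion.  At a tensor T1 * T2, unswitched on the
    side of F and switched on the side of G, the graph F cannot link T1 with T2, so it
    falls apart into a piece glued along T1 and a piece glued along T2.  In the glued
    graph there is no cycle, so directed paths end, and contracting them yields the graph
    of the composite, a contraction of a tree.

    A graph is a forest iff each edge is the only edge crossing some cut A : V -> bool.
    Edges are kept directed: an edge of f and an edge of g may join the same two leaves
    of T, but then in opposite directions, so that relations suffice for multigraphs. *)

(** * Trees described by cuts instead of paths *)

Definition uncut (V : Type) (R : V -> V -> Prop) (A : V -> bool) : Prop :=
  forall x y, R x y -> A x = A y.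

Definition forest (V : Type) (R : V -> V -> Prop) : Prop :=
  forall x y, R x y -> exists2 A : V -> bool, A x <> A y &
    uncut (fun x' y' => R x' y' /\ (x', y') <> (x, y)) A.

(** [D] marks the vertices that are to be connected, since the ambient [V] also holds vertices
    outside the graph. Being a forest concerns edges only, so [forest] has no such parameter. *)
Definition connected_on (V : Type) (R : V -> V -> Prop) (D : V -> Prop) : Prop :=
  forall A : V -> bool, uncut R A -> forall x y, D x -> D y -> A x = A y.

Definition tree_on (V : Type) (R : V -> V -> Prop) (D : V -> Prop) : Prop :=
  forest R /\ connected_on R D.

Definition graphU (V : Type) (R R' : V -> V -> Prop) (x y : V) : Prop :=
  R x y \/ R' x y.

Definition within (V : Type) (R : V -> V -> Prop) (D : V -> Prop) : Prop :=
  forall x y, R x y -> D x /\ D y.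

Definition map_graph (V W : Type) (a : V -> W) (R : V -> V -> Prop) (x y : W) : Prop :=
  exists u v, [/\ R u v, x = a u & y = a v].

Lemma uncut_sub (V : Type) (R R' : V -> V -> Prop) (A : V -> bool) :
  (forall x y, R x y -> R' x y) -> uncut R' A -> uncut R A.
Proof. by move=> sub uA x y /sub; apply: uA. Qed.

Lemma forest_sub (V : Type) (R R' : V -> V -> Prop) :
  (forall x y, R x y -> R' x y) -> forest R' -> forest R.
Proof.
move=> sub fR x y /sub /fR [A Axy uA]; exists A => //.
by apply: uncut_sub uA => x' y' [/sub].
Qed.

Lemma tree_eqv (V : Type) (R R' : V -> V -> Prop) (D D' : V -> Prop) :
  (forall x y, R x y <-> R' x y) -> (forall x, D' x -> D x) ->
  tree_on R D -> tree_on R' D'.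
Proof.
move=> eqR subD [fR cR]; split; first by apply: forest_sub fR => x y /eqR.
move=> A uA x y /subD Dx /subD Dy; apply: cR => //.
by apply: uncut_sub uA => u v /eqR.
Qed.

Lemma tree_map (V W : Type) (a : V -> W) (R : V -> V -> Prop) :
  injective a -> tree_on R (fun=> True) ->
  tree_on (map_graph a R) (fun x => exists u, x = a u).
Proof.
move=> inja [fR cR]; split=> [x y|A uA x y].
  move=> [u [v [Ruv -> ->]]]; have [A Auv uA] := fR _ _ Ruv.
  have AE w : `[< exists2 z, a w = a z & A z >] = A w.
    apply/asboolP/idP => [[z /inja -> //]|Aw]; by exists w.
  exists (fun w => `[< exists2 z, w = a z & A z >]); first by rewrite !AE.
  move=> x' y' [[u' [v' [Ruv' -> ->]]] ne]; rewrite !AE; apply: uA; split => //.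
  by move=> [eu ev]; apply: ne; rewrite eu ev.
move=> [u ->] [v ->]; apply: (cR (A \o a)) => // u' v' Ruv'.
by apply: uA; exists u', v'.
Qed.

(** [R] orients each edge of [e] in one way: two opposite edges of [R] would be a cycle that [e]
    does not see. Removing an edge from an acyclic graph separates its ends, which gives the cut;
    conversely, going round a cycle the long way crosses no cut that isolates one of its edges. *)
Lemma is_treeP (V : finType) (e : rel V) (R : V -> V -> Prop) :
  (forall x y, R x y -> ~ R y x) -> (forall x y, e x y <-> R x y \/ R y x) ->
  is_tree e <-> tree_on R (fun=> True).
Proof.
move=> antiR eR; split=> [[con cyc]|[fR cR]].
  split=> [x y Rxy|A uA x y _ _]; last first.
    have /connectP [p] := con x y.
    elim: p x => [|z p IH] x /= => [_ -> //|/andP[/eR exz pz] yE].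
    by rewrite -(IH _ pz yE); case: exz => /uA.
  (* [e'] is [e] without the edge between [x] and [y]; the cut is the component of [x] in [e']. If
     [y] were in it, a simple path from [x] to [y] would close up to a cycle. *)
  pose e' u v := [&& e u v, (u, v) != (x, y) & (u, v) != (y, x)].
  have e'C u v : e' u v = e' v u.
    rewrite /e'; have -> : e u v = e v u by apply/idP/idP => /eR H; apply/eR; case: H; auto.
    by congr (_ && _); rewrite andbC !xpair_eqE; congr (~~ _ && ~~ _); apply: andbC.
  exists (connect e' x); last first.
    move=> u v [Ruv ne]; apply/idP/idP => H; apply: (connect_trans H); apply: connect1.
      rewrite /e'; apply/and3P; split; [by apply/eR; left|exact/eqP|].
      by apply/eqP => -[? ?]; subst; apply: antiR Rxy.
    rewrite e'C /e'; apply/and3P; split; [by apply/eR; left|exact/eqP|].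
    by apply/eqP => -[? ?]; subst; apply: antiR Rxy.
  rewrite connect0 => /esym /connectP [p pP yE].
  case/shortenP: pP yE => {}p pP up _ yE.
  have: ucycle e (x :: p).
    rewrite /ucycle up andbT /= rcons_path -yE; apply/andP; split; last by apply/eR; right.
    by apply: sub_path pP => u v /and3P[].
  (* Size at most 2 leaves two cases: [p] empty, so that [x = y] and [R] has a loop, or [p] a single
     vertex, so that the path is the removed edge. *)
  move=> /cyc; case: p pP yE {up} => [_ xy|z [|w p]] //=.
    by subst y; case: (antiR _ _ Rxy).
  by move=> + yE; rewrite -yE /e' eqxx /= andbF.
have uncute A : uncut R A -> forall x y, e x y -> A x = A y.
  by move=> uA x y /eR [] /uA.
split=> [x y|c].
  rewrite -(cR (connect e x) _ x y) ?connect0 //.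
  move=> u v Ruv; apply/idP/idP => H; apply: (connect_trans H); apply: connect1.
    by apply/eR; left.
  by apply/eR; right.
case: c => [|x [|y [|z q]]] //; rewrite /ucycle => /andP[cyc /= /and3P[xN yN _]].
have [A Axy uA] : exists2 A : V -> bool, A x <> A y & forall u v, e u v ->
    (u, v) <> (x, y) -> (u, v) <> (y, x) -> A u = A v.
  have : e x y by move: cyc => /= /andP[].
  move=> /eR [] /fR [A Axy uA]; exists A; try exact/nesym; try by [].
    move=> u v /eR [Ruv|Rvu] n1 n2; first exact: uA.
    by symmetry; apply: uA; split => // -[? ?]; subst.
  move=> u v /eR [Ruv|Rvu] n1 n2; first exact: uA.
  by symmetry; apply: uA; split => // -[? ?]; subst.
case: Axy; move: cyc; rewrite /= => /and3P[_ eyz]; rewrite rcons_path => /andP[pz lx].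
have zx : z != x by apply: contraNneq xN => ->; rewrite !inE eqxx orbT.
rewrite (uA y z) //; last 2 first.
- by move=> [yx _]; move: xN; rewrite yx inE eqxx.
- by move=> [zx']; move: zx; rewrite zx' eqxx.
have /= xNz : x \notin z :: q by move: xN; rewrite inE negb_or => /andP[].
elim: q z pz lx yN {xN eyz zx} xNz => [|w q IH] z /=.
  move=> _ ezx; rewrite inE => yz xNz; symmetry; apply: uA => //.
    by move=> [zx _]; move: xNz; rewrite zx inE eqxx.
  by move=> [zy]; move: yz; rewrite zy eqxx.
move=> /andP[ezw pw] lx; rewrite inE negb_or => /andP[yz yN]; rewrite inE negb_or => /andP[xz xN].
rewrite (IH w pw lx yN xN); symmetry; apply: uA => //.
  by move=> [zx]; move: xz; rewrite zx eqxx.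
by move=> [zy]; move: yz; rewrite zy eqxx.
Qed.

(** * Switched parse trees *)

(* In the graph of a leaf function from [S] to [T], [p] is [true] for [S] and [false]
   for [T]. *)
Definition shape_edge (A : Type) (T : star_shape A) (p : bool) (sw : vertex T -> bool)
    (u v : vertex T) : Prop :=
  exists2 i, argument_edge i u v & ~~ [&& is_tensor u, is_positive u == p & sw u == i].

Definition tensor_switch (A : Type) (T1 T2 : star_shape A) (b : bool)
    (sw1 : vertex T1 -> bool) (sw2 : vertex T2 -> bool)
    (v : vertex (Tensor T1 T2)) : bool :=
  match v with None => b | Some (inl u) => sw1 u | Some (inr u) => sw2 u end.

(** The root is positive, so it is switched exactly when [p] is true; then [b] deletes the right
    edge if true and the left edge if false. *)
Lemma shape_edge_tensor (A : Type) (T1 T2 : star_shape A) (p b : bool)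
    (sw1 : vertex T1 -> bool) (sw2 : vertex T2 -> bool) (V : Type)
    (a : vertex (Tensor T1 T2) -> V) (x y : V) :
  map_graph a (shape_edge p (tensor_switch b sw1 sw2)) x y <->
  [\/ map_graph (fun u => a (Some (inl u))) (shape_edge p sw1) x y,
      map_graph (fun u => a (Some (inr u))) (shape_edge p sw2) x y,
      [/\ x = a None, y = a (Some (inl (shape_root T1))) & ~~ (p && ~~ b)] |
      [/\ x = a None, y = a (Some (inr (shape_root T2))) & ~~ (p && b)]].
Proof.
split.
  move=> [[[u|u]|] [[[v|v]|] []]] //= [i] //= iuv keep -> ->.
  - by apply: Or41; exists u, v; split=> //; exists i.
  - by apply: Or42; exists u, v; split=> //; exists i.
  - move/andP: iuv keep => [/negbTE-> /eqP->] keep; apply: Or43; split => //.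
    by move: keep; rewrite /is_tensor /=; case: p b => [] [].
  - move/andP: iuv keep => [-> /eqP->] keep; apply: Or44; split => //.
    by move: keep; rewrite /is_tensor /=; case: p b => [] [].
case.
- by move=> [u [v [[i iuv k] -> ->]]]; exists (Some (inl u)), (Some (inl v)); split=> //; exists i.
- by move=> [u [v [[i iuv k] -> ->]]]; exists (Some (inr u)), (Some (inr v)); split=> //; exists i.
- move=> [-> -> k]; exists None, (Some (inl (shape_root T1))); split=> //; exists false => /=.
    by rewrite eqxx.
  by move: k; rewrite /is_tensor /=; case: p b => [] [].
- move=> [-> -> k]; exists None, (Some (inr (shape_root T2))); split=> //; exists true => /=.
    by rewrite eqxx.
  by move: k; rewrite /is_tensor /=; case: p b => [] [].
Qed.

Definition dual_switch (A : Type) (T : star_shape A) (sw : vertex T -> bool)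
    (v : vertex (Dual T)) : bool :=
  if v is Some u then sw u else true.

(** Signs flip below a dual, hence [~~ p] for the argument; the edge at the dual itself survives
    every switching. *)
Lemma shape_edge_dual (A : Type) (T : star_shape A) (p : bool)
    (sw : vertex T -> bool) (V : Type) (a : vertex (Dual T) -> V) (x y : V) :
  map_graph a (shape_edge p (dual_switch sw)) x y <->
  map_graph (fun u => a (Some u)) (shape_edge (~~ p) sw) x y \/
  (x = a None /\ y = a (Some (shape_root T))).
Proof.
split.
  move=> [[u|] [[v|] []]] //= [i] //= iuv keep -> ->.
    left; exists u, v; split=> //; exists i => //.
    by move: keep; rewrite /is_tensor /= eqb_negLR.
  by right; move/andP: iuv => [_ /eqP->].
case.
  move=> [u [v [[i iuv k] -> ->]]]; exists (Some u), (Some v); split=> //; exists i => //.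
  by move: k; rewrite /is_tensor /= eqb_negLR.
move=> [-> ->]; exists None, (Some (shape_root T)); by split=> //; exists false; rewrite //= ?eqxx.
Qed.

(** At each tensor above [u] the switching deletes the edge that leads away from [u], so the path
    from the root to [u] survives. *)
Lemma root_switch (A : Type) (T : star_shape A) (p : bool) (u : vertex T) :
  exists sw : vertex T -> bool, forall c : vertex T -> bool,
    uncut (shape_edge p sw) c -> c u = c (shape_root T).
Proof.
elim: T p u => [x|T1 IH1 T2 IH2|T1 IH1] p u.
- by exists xpredT => c _; case: u.
- case: u => [[u|u]|] /=; last by exists xpredT.
    have [sw swP] := IH1 p u; exists (tensor_switch true sw xpredT) => c uc.
    rewrite (swP (fun v => c (Some (inl v)))); last first.
      by move=> x y [i exy k]; apply: uc; exists i.
    by symmetry; apply: uc; exists false; rewrite /= ?eqxx // !andbF.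
  have [sw swP] := IH2 p u; exists (tensor_switch false xpredT sw) => c uc.
  rewrite (swP (fun v => c (Some (inr v)))); last first.
    by move=> x y [i exy k]; apply: uc; exists i.
  by symmetry; apply: uc; exists true; rewrite /= ?eqxx // !andbF.
- case: u => [u|]; last by exists xpredT.
  have [sw swP] := IH1 (~~ p) u; exists (dual_switch sw) => c uc.
  rewrite (swP (fun v => c (Some v))); last first.
    move=> x y [i exy k]; apply: uc; exists i => //.
    by move: k; rewrite /is_tensor /= eqb_negLR.
  by symmetry; apply: uc; exists false; rewrite /= ?eqxx.
Qed.

(** * Gluing two trees along a shape *)

Definition adjoin (V : Type) (D D' : V -> Prop) (x : V) : Prop := D x \/ D' x.
Definition image_of (U V : Type) (a : U -> V) (x : V) : Prop := exists u, x = a u.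

(* [a] draws [T] in the ambient vertex set [V], in which [F] and [G] meet [T], and
   each other, only in leaves of [T]. *)
Definition gluable (A : Type) (T : star_shape A) : Prop :=
  forall (V : Type) (p : bool) (a : vertex T -> V) (F G : V -> V -> Prop)
    (DF DG : V -> Prop),
  injective a -> within F DF -> within G DG ->
  (forall u, DF (a u) -> is_leaf u) -> (forall u, DG (a u) -> is_leaf u) ->
  (forall x, DF x -> DG x -> image_of a x) ->
  (forall sw, tree_on (graphU F (map_graph a (shape_edge p sw))) (adjoin DF (image_of a))) ->
  (forall sw, tree_on (graphU G (map_graph a (shape_edge (~~ p) sw))) (adjoin DG (image_of a))) ->
  tree_on (graphU F G) (adjoin DF DG).

(** A cut of [F] extends over [G] by its value at [t], the only vertex the two graphs can share, so
    that no edge of [G] crosses it. *)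
Lemma point_glue_cut (V : Type) (t : V) (F G : V -> V -> Prop) (DF DG : V -> Prop) :
  within F DF -> within G DG -> (forall x, DF x -> DG x -> x = t) -> forest F ->
  forall x y, F x y -> exists2 A : V -> bool, A x <> A y &
    uncut (fun x' y' => graphU F G x' y' /\ (x', y') <> (x, y)) A.
Proof.
move=> wF wG FG fF x y Fxy; have [A Axy uA] := fF _ _ Fxy.
pose B v := if `[< DF v >] then A v else A t.
have BF v : DF v -> B v = A v by rewrite /B => /asboolP ->.
have BG v : DG v -> B v = A t.
  by rewrite /B; case: asboolP => // Fv Gv; rewrite (FG v).
exists B; first by have [Fx Fy] := wF _ _ Fxy; rewrite !BF.
move=> x' y' [[Fxy'|/wG[? ?]] ne]; last by rewrite !BG.
by have [? ?] := wF _ _ Fxy'; rewrite !BF //; apply: uA.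
Qed.

Lemma graphUC (V : Type) (F G : V -> V -> Prop) (x y : V) :
  graphU F G x y <-> graphU G F x y.
Proof. by rewrite /graphU; tauto. Qed.

Lemma gluable_atom (A : Type) (x : atom A) : gluable (Atom x).
Proof.
move=> V p a F G DF DG inja wF wG _ _ FG treeF treeG; set t := a tt.
have {}FG v : DF v -> DG v -> v = t by move=> Fv /(FG _ Fv) [[]].
(* The parse tree of an atom has no edges, so the hypotheses say that [F] and [G] are trees, each
   with [t] among its vertices. *)
have F0 R q : tree_on (graphU R (map_graph a (shape_edge (T := Atom x) q xpredT)))
    =1 tree_on R.
  move=> D; congr (tree_on _ D); apply/funext => u; apply/funext => v; apply/propext.
  by split=> [[//|[? [? [[? //]]]]]|]; left.
have := treeF xpredT; rewrite F0 => -[fF cF]; have := treeG xpredT; rewrite F0 => -[fG cG].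
split.
  move=> u v [Fuv|Guv]; first exact: point_glue_cut wF wG FG fF _ _ Fuv.
  have [B Buv uB] := point_glue_cut wG wF (fun x Gx Fx => FG x Fx Gx) fG Guv.
  by exists B => //; apply: uncut_sub uB => ? ? [/graphUC].
move=> B uB; have At v : adjoin DF DG v -> B v = B t.
  case=> Dv; [apply: cF|apply: cG]; try by [left|right; exists tt].
    by apply: uncut_sub uB; left.
  by apply: uncut_sub uB; right.
by move=> u v /At -> /At ->.
Qed.

(* [C] cuts out of [F] the part that meets [X]; the rest of the tree hangs from [r1]. *)
Lemma tree_half (V : Type) (F X Y : V -> V -> Prop) (DF DX DY : V -> Prop)
    (r r1 r2 : V) (C : V -> bool) :
  within F DF -> within X DX -> within Y DY -> DX r1 -> DY r2 ->
  ~ DF r -> ~ DX r -> (forall v, DX v -> ~ DY v) ->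
  uncut F C -> (forall v, DF v -> DX v -> C v) -> (forall v, DF v -> DY v -> ~~ C v) ->
  tree_on (fun x y => [\/ F x y, X x y, Y x y | x = r /\ (y = r1 \/ y = r2)])
    (fun v => DF v \/ DX v) ->
  tree_on (graphU (fun x y => F x y /\ C x) X) (adjoin (fun v => DF v /\ C v) DX).
Proof.
move=> wF wX wY X1 Y2 nFr nXr XY uC CX CY [fR cR]; split.
  apply: forest_sub fR => x y [[Fxy _]|Xxy]; by [apply: Or41|apply: Or42].
move=> A uA.
pose H v := DX v \/ (DF v /\ C v).
(* [B] collapses everything outside [H] to the value at [r1]. Since [C] is constant along edges of
   [F], each of them lies wholly inside or wholly outside [H], and only the edge from [r] to [r1]
   joins the two regions. *)
pose B v := if `[< H v >] then A v else A r1.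
have BH v : H v -> B v = A v by rewrite /B => /asboolP ->.
have BN v : ~ H v -> B v = A r1 by rewrite /B; case: asboolP.
have NY v : DY v -> ~ H v.
  by move=> Yv [/XY//|[/CY /(_ Yv) /negP]].
have Nr : ~ H r by case=> [//|[]].
have uB : uncut (fun x y => [\/ F x y, X x y, Y x y | x = r /\ (y = r1 \/ y = r2)]) B.
  move=> x y [Fxy|Xxy|Yxy|[-> [->|->]]].
  - have [Fx Fy] := wF _ _ Fxy; have Cxy := uC _ _ Fxy; case Cx: (C x).
      rewrite !BH; [by apply: uA; left|by right; split=> //; rewrite -Cxy|by right].
    rewrite !BN // => -[/CX|[_]]; first by move=> /(_ Fy); rewrite -Cxy Cx.
    - by rewrite -Cxy Cx.
    - by move=> /(_ Fx); rewrite Cx.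
    - by rewrite Cx.
  - by have [Xx Xy] := wX _ _ Xxy; rewrite !BH; [apply: uA; right|left|left].
  - by have [/NY Yx /NY Yy] := wY _ _ Yxy; rewrite !BN.
  - by rewrite BN // BH //; left.
  - by rewrite !BN //; exact: NY.
move=> x y Dx Dy; have HD v : adjoin (fun v => DF v /\ C v) DX v -> H v.
  by case=> ?; [right|left].
rewrite -(BH x (HD x Dx)) -(BH y (HD y Dy)); apply: cR => //.
  by case: Dx => [[]|]; [left|right].
by case: Dy => [[]|]; [left|right].
Qed.

(** [R] does not touch [r], so any indicator without crossing edges extends to [r] by its value at
    [s]. This discards the root of a dual, or of a switched tensor. *)
Lemma tree_remove_pendant (V : Type) (R : V -> V -> Prop) (D : V -> Prop) (r s : V) :
  within R D -> D s -> ~ D r ->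
  tree_on (fun x y => R x y \/ (x = r /\ y = s)) (fun v => D v \/ v = r) -> tree_on R D.
Proof.
move=> wR Ds nDr [fR cR]; split; first by apply: forest_sub fR; left.
move=> A uA; pose B v := if `[< v = r >] then A s else A v.
have BD v : D v -> B v = A v by rewrite /B; case: asboolP => // ->.
have Br : B r = A s by rewrite /B; case: asboolP.
move=> x y Dx Dy; rewrite -BD // -(BD y) //; apply: cR; [|by left|by left].
move=> u v [Ruv|[-> ->]]; last by rewrite Br BD.
by have [Du Dv] := wR _ _ Ruv; rewrite !BD //; apply: uA.
Qed.

Lemma within_map (U V : Type) (a : U -> V) (R : U -> U -> Prop) :
  within (map_graph a R) (image_of a).
Proof. by move=> x y [u [v [_ -> ->]]]; split; [exists u|exists v]. Qed.

Lemma within_graphU (V : Type) (R R' : V -> V -> Prop) (D D' : V -> Prop) :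
  within R D -> within R' D' -> within (graphU R R') (adjoin D D').
Proof.
by move=> wR wR' x y [/wR|/wR'] [? ?]; split; [left|left|right|right].
Qed.

(* [F] cannot join a leaf of [T1] to a leaf of [T2], since some switching of [T1] and
   [T2] joins both leaves to the tensor, closing a cycle. Hence [F] splits into [F1],
   meeting only [T1], and [F2], meeting only [T2]; glue [F1] to [G] with [T2] attached,
   then glue [F2] to the result. *)
Lemma glue_tensor (A : Type) (T1 T2 : star_shape A) (V : Type)
    (a : vertex (Tensor T1 T2) -> V) (F G : V -> V -> Prop) (DF DG : V -> Prop) :
  gluable T1 -> gluable T2 ->
  injective a -> within F DF -> within G DG ->
  (forall u, DF (a u) -> is_leaf u) -> (forall u, DG (a u) -> is_leaf u) ->
  (forall x, DF x -> DG x -> image_of a x) ->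
  (forall sw, tree_on (graphU F (map_graph a (shape_edge false sw))) (adjoin DF (image_of a))) ->
  (forall sw, tree_on (graphU G (map_graph a (shape_edge true sw))) (adjoin DG (image_of a))) ->
  tree_on (graphU F G) (adjoin DF DG).
Proof.
move=> glue1 glue2 inja wF wG leafF leafG FG treeF treeG.
pose a1 u := a (Some (inl u)); pose a2 u := a (Some (inr u)); pose r := a None.
pose r1 := a1 (shape_root T1); pose r2 := a2 (shape_root T2).
have inja1 : injective a1 by move=> u v /inja [].
have inja2 : injective a2 by move=> u v /inja [].
have a12 v : image_of a1 v -> ~ image_of a2 v by move=> [u ->] [w /inja].
have ra1 : ~ image_of a1 r by move=> [u /inja].
have ra2 : ~ image_of a2 r by move=> [u /inja].
have rF : ~ DF r by move/leafF.
have rG : ~ DG r by move/leafG.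
have fullF sw1 sw2 : tree_on (fun x y => [\/ F x y, map_graph a1 (shape_edge false sw1) x y,
      map_graph a2 (shape_edge false sw2) x y | x = r /\ (y = r1 \/ y = r2)])
    (fun v => DF v \/ image_of a v).
  apply: tree_eqv (treeF (tensor_switch true sw1 sw2)) => // x y; rewrite /graphU shape_edge_tensor.
  split=> [[|[]]|[]]; try by [apply: Or41|apply: Or42|apply: Or43].
  - by move=> [-> -> _]; apply: Or44; split=> //; left.
  - by move=> [-> -> _]; apply: Or44; split=> //; right.
  - by left.
  - by right; apply: Or41.
  - by right; apply: Or42.
  - by move=> [-> [->|->]]; right; [apply: Or43|apply: Or44].
have sepF u1 u2 : exists2 B, uncut F B & B (a1 u1) && ~~ B (a2 u2).
  have [sw1 sw1P] := root_switch false u1; have [sw2 sw2P] := root_switch false u2.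
  have [fF _] := fullF sw1 sw2.
  (* The cut at the edge from [r] to [r1]: [a1 u1] is on the side of [r1], while [a2 u2] is on the
     side of [r2], which is that of [r]. *)
  have [|B Brr uB] := fF r r1; first by apply: Or44; split=> //; left.
  have uBF : uncut F B.
    move=> x y Fxy; apply: uB; split; first exact: Or41.
    by have [Fx _] := wF _ _ Fxy; move=> [xr _]; rewrite xr in Fx.
  have B1 : B (a1 u1) = B r1.
    apply: (sw1P (B \o a1)) => x y exy; apply: uB; split; first by apply: Or42; exists x, y.
    by move=> [/inja].
  have B2 : B (a2 u2) = B r.
    transitivity (B r2).
      apply: (sw2P (B \o a2)) => x y exy; apply: uB; split; first by apply: Or43; exists x, y.
      by move=> [/inja].
    by symmetry; apply: uB; split; [apply: Or44; split=> //; right|move=> [/inja]].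
  case B1E: (B (a1 u1)).
    by exists B => //; rewrite B1E B2; move: Brr; rewrite -B1 B1E; case: (B r).
  exists (fun v => ~~ B v); first by move=> x y /uBF ->.
  by rewrite B1E B2; move: Brr; rewrite -B1 B1E; case: (B r).
(* [C] is the union of the components of [F] that contain a vertex of [T1], with components
   expressed through uncut indicators. *)
pose C v := `[< exists u1, forall B, uncut F B -> B (a1 u1) -> B v >].
have uC : uncut F C.
  move=> x y Fxy; apply/asboolP/asboolP => -[u uP]; exists u => B uB Bu.
    by rewrite -(uB _ _ Fxy); apply: uP.
  by rewrite (uB _ _ Fxy); apply: uP.
have C1 u : C (a1 u) by apply/asboolP; exists u.
have C2 u : ~~ C (a2 u).
  apply/asboolPn => -[u1 uP]; have [B uB /andP[B1 /negP]] := sepF u1 u.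
  by apply; apply: uP.
pose F1 x y := F x y /\ C x; pose F2 x y := F x y /\ ~~ C x.
pose DF1 v := DF v /\ C v; pose DF2 v := DF v /\ ~~ C v.
have wF1 : within F1 DF1.
  by move=> x y [Fxy Cx]; have [? ?] := wF _ _ Fxy; split; split; rewrite -?(uC _ _ Fxy).
have wF2 : within F2 DF2.
  by move=> x y [Fxy Cx]; have [? ?] := wF _ _ Fxy; split; split; rewrite -?(uC _ _ Fxy).
have half1 sw1 : tree_on (graphU F1 (map_graph a1 (shape_edge false sw1)))
    (adjoin DF1 (image_of a1)).
  apply: (tree_half (r := r) (r1 := r1) (r2 := r2) (Y := map_graph a2 (shape_edge false xpredT))
      wF (@within_map _ _ a1 _) (@within_map _ _ a2 _)) => //.
  - by exists (shape_root T1).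
  - by exists (shape_root T2).
  - by move=> v _ [u ->].
  - by move=> v _ [u ->].
  - apply: tree_eqv (fullF sw1 xpredT) => // v [|[u ->]]; first by left.
    by right; exists (Some (inl u)).
have half2 sw2 : tree_on (graphU F2 (map_graph a2 (shape_edge false sw2)))
    (adjoin DF2 (image_of a2)).
  apply: (tree_half (r := r) (r1 := r2) (r2 := r1) (Y := map_graph a1 (shape_edge false xpredT))
      (C := fun v => ~~ C v) wF (@within_map _ _ a2 _) (@within_map _ _ a1 _)) => //.
  - by exists (shape_root T2).
  - by exists (shape_root T1).
  - by move=> v ? /a12.
  - by move=> x y /uC ->.
  - by move=> v _ [u ->].
  - by move=> v _ [u ->]; rewrite negbK.
  - apply: tree_eqv (fullF xpredT sw2) => [x y|v [|[u ->]]]; last 2 first.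
    + by left.
    + by right; exists (Some (inr u)).
    by split=> -[||| [-> [->|->]]]; try by [apply: Or41|apply: Or42|apply: Or43];
      apply: Or44; split=> //; by [left|right].
(* The root is switched on the side of [G]. The switch [true] deletes its edge to [T2], so [r] hangs
   from [r1] alone and can be removed. *)
have pendG sw1 sw2 : tree_on
    (graphU (graphU G (map_graph a2 (shape_edge true sw2))) (map_graph a1 (shape_edge true sw1)))
    (adjoin (adjoin DG (image_of a2)) (image_of a1)).
  apply: (tree_remove_pendant (r := r) (s := r1)).
  - by apply: within_graphU; [apply: within_graphU|] => //; exact: within_map.
  - by right; exists (shape_root T1).
  - by case=> [[]|].
  apply: tree_eqv (treeG (tensor_switch true sw1 sw2)) => [x y|v].
    rewrite /graphU shape_edge_tensor; split=> [[|[]]|]; try by tauto.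
    - by move=> [-> -> _]; right.
    - by move=> [].
    case=> [[[]|]|[-> ->]].
    + by left.
    + by right; apply: Or42.
    + by right; apply: Or41.
    + by right; apply: Or43.
  case=> [[[|[u ->]]|[u ->]]|->]; first by left.
  - by right; exists (Some (inr u)).
  - by right; exists (Some (inl u)).
  - by right; exists None.
(* Here [T2] counts as part of the graph opposite to [F1]. The shared vertices lie in [T1] because
   [C] fails on [T2]. *)
have step1 sw2 : tree_on (graphU F1 (graphU G (map_graph a2 (shape_edge true sw2))))
    (adjoin DF1 (adjoin DG (image_of a2))).
  apply: (glue1 V false a1) => //.
  - by apply: within_graphU => //; exact: within_map.
  - by move=> u [/leafF].
  - by move=> u [/leafG //|[w /inja]].
  - move=> x [Fx Cx] [Gx|[u xE]]; last by move: Cx (C2 u); rewrite xE => ->.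
    have [[[u|u]|] xE] := FG _ Fx Gx; first by exists u.
      by move: (C2 u) Cx; rewrite xE /a2 => /negbTE ->.
    by move: rF; rewrite /r -xE.
(* Now [F1] and [G] together form the graph opposite to [F2]; [step1] says that it becomes a tree
   when any switching of [T2] is attached. *)
have: tree_on (graphU F2 (graphU F1 G)) (adjoin DF2 (adjoin DF1 DG)).
  apply: (glue2 V false a2) => //.
  - exact: within_graphU.
  - by move=> u [/leafF].
  - by move=> u [[/leafF]|/leafG].
  - move=> x [Fx nCx] [[_ Cx]|Gx]; first by rewrite Cx in nCx.
    have [[[u|u]|] xE] := FG _ Fx Gx; last by move: rF; rewrite /r -xE.
      by move: (C1 u) nCx; rewrite xE /a1 => ->.
    by exists u.
  - move=> sw2; apply: tree_eqv (step1 sw2) => [x y|v]; rewrite /graphU /adjoin; tauto.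
apply: tree_eqv => [x y|v]; rewrite /graphU /adjoin /F1 /F2 /DF1 /DF2.
  by split=> [|[]]; [tauto|case: (C x) => ?; by [left|right; left]|tauto].
by case: (C v) => -[?|?]; by [left|right; left|right; right].
Qed.

Lemma every_gluable (A : Type) (T : star_shape A) : gluable T.
Proof.
elim: T => [x|T1 IH1 T2 IH2|T IH]; first exact: gluable_atom.
  (* [glue_tensor] has the switched root on the side of [G]; for [p = true] the roles of [F] and [G]
     are exchanged. *)
  move=> V [] a F G DF DG inja wF wG leafF leafG FG treeF treeG; last first.
    exact: (glue_tensor (a := a)).
  have FG' x : DG x -> DF x -> image_of a x by move=> Gx Fx; apply: FG.
  have := glue_tensor IH1 IH2 inja wG wF leafG leafF FG' treeG treeF.
  by apply: tree_eqv => [x y|v]; rewrite /graphU /adjoin; tauto.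
move=> V p a F G DF DG inja wF wG leafF leafG FG treeF treeG.
pose a1 u := a (Some u).
(* On either side the dual vertex is pendant above the root of its argument; removing it leaves the
   situation for [T] with the opposite sign. *)
have drop q R D : within R D -> (forall u, D (a u) -> is_leaf u) ->
    (forall sw, tree_on (graphU R (map_graph a (shape_edge q sw))) (adjoin D (image_of a))) ->
    forall sw, tree_on (graphU R (map_graph a1 (shape_edge (~~ q) sw))) (adjoin D (image_of a1)).
  move=> wR leafD treeR sw.
  apply: (tree_remove_pendant (r := a None) (s := a1 (shape_root T))).
  - by apply: within_graphU => //; exact: within_map.
  - by right; exists (shape_root T).
  - by case=> [/leafD|[u /inja]].
  apply: tree_eqv (treeR (dual_switch sw)) => [x y|v].
    by rewrite /graphU shape_edge_dual /a1; tauto.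
  case=> [[|[u ->]]|->]; first by left.
    by right; exists (Some u).
  by right; exists None.
apply: (IH V (~~ p) a1) => //.
- by move=> u v /inja [].
- by move=> u /leafF.
- by move=> u /leafG.
- move=> x Fx Gx; have [[u|] xE] := FG _ Fx Gx; first by exists u.
  by move: Fx; rewrite xE => /leafF.
- exact: drop.
- exact: drop.
Qed.

(** * Switchings of a leaf function as directed graphs *)

Lemma argument_edge_nonleaf (A : Type) (T : star_shape A) (i : bool) (u v : vertex T) :
  argument_edge i u v -> ~~ is_leaf u.
Proof.
by elim: T u v => [//|T1 IH1 T2 IH2 [[u|u]|] [[v|v]|]|T1 IH1 [u|] [v|]] //=;
  [apply: IH1|apply: IH2|apply: IH1].
Qed.

Lemma argument_edge_asym (A : Type) (T : star_shape A) (i j : bool) (u v : vertex T) :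
  argument_edge i u v -> ~~ argument_edge j v u.
Proof.
by elim: T u v => [//|T1 IH1 T2 IH2 [[u|u]|] [[v|v]|]|T1 IH1 [u|] [v|]] //=;
  [apply: IH1|apply: IH2|apply: IH1].
Qed.

(** The switching with orientation: from a vertex to its arguments, and along [f]. This meets the
    antisymmetry demanded by [is_treeP]. *)
Definition linking_graph (A : Type) (S T : star_shape A) (f : leaf_function S T)
    (s1 : vertex S -> bool) (s2 : vertex T -> bool) (x y : graph_vertex S T) : Prop :=
  [\/ map_graph inl (shape_edge true s1) x y, map_graph inr (shape_edge false s2) x y |
      graph_leaf_edge f x y].

Lemma graph_leaf_edgeP (A : Type) (S T : star_shape A) (f : leaf_function S T)
    (x y : graph_vertex S T) :
  graph_leaf_edge f x y <->
  exists2 l, x = leaf_vertex (dom_leaf l) & y = leaf_vertex (cod_leaf (f l)).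
Proof.
split=> [/existsP[l /andP[/eqP-> /eqP->]]|[l -> ->]]; first by exists l.
by apply/existsP; exists l; rewrite !eqxx.
Qed.

Lemma switching_treeP (A : Type) (S T : star_shape A) (f : leaf_function S T)
    (sw : graph_vertex S T -> bool) :
  is_tree (switching f sw) <->
  tree_on (linking_graph f (fun u => sw (inl u)) (fun v => sw (inr v))) (fun=> True).
Proof.
have domN l z : ~ map_graph (W := graph_vertex S T) inl (shape_edge true (fun u => sw (inl u)))
    (leaf_vertex l) z /\
  ~ map_graph (W := graph_vertex S T) inr (shape_edge false (fun u => sw (inr u)))
    (leaf_vertex l) z.
  split=> -[u [v [[i /argument_edge_nonleaf nl _]]]]; case: l => l //= [ul] _;
    by move: nl; rewrite -ul (valP l).
apply: is_treeP => [x y|x y].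
  (* No edge has a reverse: argument edges descend from vertices that are not leaves, and a leaf
     edge runs from [leaf_dom] to [leaf_cod], which differ in sign. *)
  case=> [[u [v [[i uv _] -> ->]]]|[u [v [[i uv _] -> ->]]]|/graph_leaf_edgeP [l -> ->]].
  - case=> [[u' [v' [[j uv' _] [vu] [uv'']]]]|[u' [v' [[j uv' _] //]]]|/graph_leaf_edgeP].
      by subst; move: (argument_edge_asym j uv); rewrite uv'.
    move=> [l _]; case: (cod_leaf _) => // k [uk].
    by move: (argument_edge_nonleaf uv); rewrite uk (valP k).
  - case=> [[u' [v' [[j uv' _] //]]]|[u' [v' [[j uv' _] [vu] [uv'']]]]|/graph_leaf_edgeP].
      by subst; move: (argument_edge_asym j uv); rewrite uv'.
    move=> [l _]; case: (cod_leaf _) => // k [uk].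
    by move: (argument_edge_nonleaf uv); rewrite uk (valP k).
  - case=> [m|m|/graph_leaf_edgeP[l2]].
    + by case: (domN (cod_leaf (f l)) (leaf_vertex (dom_leaf l))).
    + by case: (domN (cod_leaf (f l)) (leaf_vertex (dom_leaf l))).
    by case: (f l) l2 => [[k kP]|[k kP]] [[k2 k2P]|[k2 k2P]] //= [/val_inj kk] _;
      subst k; [rewrite k2P in kP|rewrite kP in k2P].
rewrite /switching.
have keptP x' y' : reflect (map_graph inl (shape_edge true (fun u => sw (inl u))) x' y' \/
    map_graph inr (shape_edge false (fun u => sw (inr u))) x' y')
    [exists i : bool, graph_argument_edge i x' y' && ~~ (switched x' && (sw x' == i))].
  apply: (iffP existsP) => [[i /andP[]]|].
    case: x' y' => [u|u] [v|v] //= uv k; [left|right]; exists u, v; split=> //; exists i => //.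
      by rewrite eqb_id andbA.
    by rewrite eqbF_neg andbA.
  case=> -[u [v [[i uv k] -> ->]]]; exists i; rewrite /= uv /=.
    by move: k; rewrite eqb_id andbA.
  by move: k; rewrite eqbF_neg andbA.
rewrite /linking_graph; split.
  case/or4P=> [/keptP[]|/keptP[]|->|->]; by [left; apply: Or31|left; apply: Or32|
    right; apply: Or31|right; apply: Or32|left; apply: Or33|right; apply: Or33].
by case=> -[m|m|l]; apply/or4P; try by [apply: Or43|apply: Or44];
  [apply: Or41|apply: Or41|apply: Or42|apply: Or42]; apply/keptP; by [left|right].
Qed.

Lemma linking_treeP (A : Type) (S T : star_shape A) (f : leaf_function S T) :
  (forall sw, is_tree (switching f sw)) <->
  (forall s1 s2, tree_on (linking_graph f s1 s2) (fun=> True)).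
Proof.
split=> [H s1 s2|H sw]; last exact/switching_treeP.
exact: (proj1 (switching_treeP f (fun x => match x with inl u => s1 u | inr v => s2 v end))).
Qed.

(** * Reachability in finite directed graphs *)

Lemma connect_step (X : finType) (e : rel X) (x y : X) :
  connect e x y -> x = y \/ exists2 z, e x z & connect e z y.
Proof.
case/connectP => -[|z p] /=; first by left.
by case/andP=> xz pz ->; right; exists z => //; apply/connectP; exists p.
Qed.

(** Since no edge enters [a], a path that starts elsewhere never meets it, so edges out of [a] may
    change [c]. *)
Lemma connect_avoid (X : finType) (e : rel X) (c : X -> bool) (a x y : X) :
  (forall u, ~~ e u a) -> (forall u v, e u v -> u <> a -> c u = c v) ->
  x <> a -> connect e x y -> c x = c y.
Proof.
move=> noa ce + /connectP[p]; elim: p x => [|z p IH] x xa /= => [_ -> //|/andP[xz pz] yE].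
by rewrite (ce _ _ xz xa); apply: IH => // za; move: (noa x); rewrite -za xz.
Qed.

Lemma connect_const (X : finType) (e : rel X) (Y : Type) (c : X -> Y) (x y : X) :
  (forall u v, e u v -> c u = c v) -> connect e x y -> c x = c y.
Proof.
move=> ce /connectP[p]; elim: p x => [|z p IH] x /= => [_ -> //|/andP[xz pz] yE].
by rewrite (ce _ _ xz); apply: IH.
Qed.

(** A simple path from [y] back to [x] meets [x] only at its end, so it does not use the edge from
    [x] to [y] and cannot cross the cut of that edge. Cycles of length two are covered, as opposite
    edges count as different. *)
Lemma forest_acyclic (X : finType) (e : rel X) (W : Type) (j : X -> W)
    (R : W -> W -> Prop) :
  injective j -> (forall x y, e x y -> R (j x) (j y)) -> forest R ->
  forall x y, e x y -> ~~ connect e y x.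
Proof.
move=> injj eR fR x y exy; apply/negP => /connectP[p pP xE].
have [B Bxy uB] := fR _ _ (eR _ _ exy); apply: Bxy.
have {}uB u v : e u v -> u <> x -> B (j u) = B (j v).
  by move=> uv ux; apply: uB; split; [exact: eR|move=> [/injj]].
case/shortenP: pP xE => {}p + + _; elim: p y {exy} => [|z p IH] y /=; first by move=> _ _ ->.
move=> /andP[yz pz] /andP[yN up] xE; rewrite (IH z) //; symmetry; apply: uB => // yx.
by move: yN; rewrite yx xE mem_last.
Qed.

(** By acyclicity, a step from [x] loses [x] from the set of reachable vertices; the induction is on
    the size of that set. *)
Lemma terminal_reach (X : finType) (e : rel X) :
  (forall x y, e x y -> ~~ connect e y x) ->
  forall x, exists2 t, connect e x t & forall y, ~~ e t y.
Proof.
move=> acyc x; have [n] := ubnP #|connect e x|.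
elim: n x => // n IH x le_n; have [/existsP[y xy]|/existsPn nx] := boolP [exists y, e x y].
  have [|t yt tP] := IH y; last by exists t => //; apply: connect_trans yt; exact: connect1.
  apply: leq_trans (le_n : _ <= n); apply: proper_card; apply/properP; split.
    by apply/fintype.subsetP => z; apply: connect_trans; exact: connect1.
  by exists x; [exact: connect0|exact: acyc].
by exists x.
Qed.

Lemma terminal_unique (X : finType) (e : rel X) (x t t' : X) :
  (forall u v w, e u v -> e u w -> v = w) -> (forall y, ~~ e t y) -> (forall y, ~~ e t' y) ->
  connect e x t -> connect e x t' -> t = t'.
Proof.
move=> fune tP t'P /connectP[p]; elim: p x => [|z p IH] x /=.
  by move=> _ <- /connect_step[//|[z]]; rewrite (negbTE (tP z)).
move=> /andP[xz pz] tE /connect_step[xt'|[z' xz' zt']].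
  by move: (t'P z); rewrite -xt' xz.
by apply: IH pz tE _; rewrite (fune _ _ _ xz xz').
Qed.

(** * Signs of leaves and the union of the edges of [f] and [g] *)

Lemma dom_leaf_inj (A : Type) (S T : star_shape A) : injective (@dom_leaf A S T).
Proof. by case=> [l|l] [l'|l'] //= [/val_inj ->]. Qed.

Lemma cod_leaf_inj (A : Type) (S T : star_shape A) : injective (@cod_leaf A S T).
Proof. by case=> [l|l] [l'|l'] //= [/val_inj ->]. Qed.

Lemma in_TU_inj (A : Type) (S T U : star_shape A) : injective (@in_TU A S T U).
Proof. by case=> [l|l] [l'|l'] //= [->]. Qed.

Lemma in_SU_inj (A : Type) (S T U : star_shape A) : injective (@in_SU A S T U).
Proof. by case=> [l|l] [l'|l'] //= [->]. Qed.

Lemma dom_ST_TU (A : Type) (S T U : star_shape A) (l : leaf_dom S T) (l' : leaf_dom T U) :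
  in_ST U (dom_leaf l) <> in_TU S (dom_leaf l').
Proof.
by case: l l' => [[k p]|[k p]] [[k' q]|[k' q]] //= -[e]; move: p q; rewrite /= e;
  case: (is_positive _).
Qed.

Lemma cod_ST_TU (A : Type) (S T U : star_shape A) (l : leaf_cod S T) (l' : leaf_cod T U) :
  in_ST U (cod_leaf l) <> in_TU S (cod_leaf l').
Proof.
by case: l l' => [[k p]|[k p]] [[k' q]|[k' q]] //= -[e]; move: p q; rewrite /= e;
  case: (is_positive _).
Qed.

Lemma cod_SU_dom_ST (A : Type) (S T U : star_shape A) (l : leaf_cod S U) (l' : leaf_dom S T) :
  in_SU T (cod_leaf l) <> in_ST U (dom_leaf l').
Proof.
by case: l l' => [[k p]|[k p]] [[k' q]|[k' q]] //= -[e]; move: p q; rewrite /= e;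
  case: (is_positive _).
Qed.

Lemma cod_SU_dom_TU (A : Type) (S T U : star_shape A) (l : leaf_cod S U) (l' : leaf_dom T U) :
  in_SU T (cod_leaf l) <> in_TU S (dom_leaf l').
Proof.
by case: l l' => [[k p]|[k p]] [[k' q]|[k' q]] //= -[e]; move: p q; rewrite /= e;
  case: (is_positive _).
Qed.

Lemma dom_SU_cod_ST (A : Type) (S T U : star_shape A) (l : leaf_dom S U) (l' : leaf_cod S T) :
  in_SU T (dom_leaf l) <> in_ST U (cod_leaf l').
Proof.
by case: l l' => [[k p]|[k p]] [[k' q]|[k' q]] //= -[e]; move: p q; rewrite /= e;
  case: (is_positive _).
Qed.

Lemma dom_SU_cod_TU (A : Type) (S T U : star_shape A) (l : leaf_dom S U) (l' : leaf_cod T U) :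
  in_SU T (dom_leaf l) <> in_TU S (cod_leaf l').
Proof.
by case: l l' => [[k p]|[k p]] [[k' q]|[k' q]] //= -[e]; move: p q; rewrite /= e;
  case: (is_positive _).
Qed.

(** Decided by sign: in [T], negative leaves are sources of [f] and positive ones are sources of
    [g]. As [f] and [g] are total, paths can stop only in [leaf_cod S U]. *)
Lemma leaf3_source (A : Type) (S T U : star_shape A) (x : leaf3 S T U) :
  [\/ exists l : leaf_cod S U, x = in_SU T (cod_leaf l),
      exists l : leaf_dom S T, x = in_ST U (dom_leaf l) |
      exists l : leaf_dom T U, x = in_TU S (dom_leaf l)].
Proof.
case: x => [[s|t]|u]; [case: (boolP (is_positive (val s))) => [sp|sn]|
  case: (boolP (is_positive (val t))) => [sp|sn]|case: (boolP (is_positive (val u))) => [sp|sn]].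
- by apply: Or32; exists (inl (exist _ s sp)).
- by apply: Or31; exists (inl (exist _ s sn)).
- by apply: Or33; exists (inl (exist _ t sp)).
- by apply: Or32; exists (inr (exist _ t sn)).
- by apply: Or31; exists (inr (exist _ u sp)).
- by apply: Or33; exists (inr (exist _ u sn)).
Qed.

(** The sign places a leaf in a codomain, but a leaf labelled [UnitI] need not be hit by any
    edge. *)
Lemma leaf3_target (A : Type) (S T U : star_shape A) (x : leaf3 S T U) :
  [\/ exists l : leaf_dom S U, x = in_SU T (dom_leaf l),
      exists l : leaf_cod S T, x = in_ST U (cod_leaf l) |
      exists l : leaf_cod T U, x = in_TU S (cod_leaf l)].
Proof.
case: x => [[s|t]|u]; [case: (boolP (is_positive (val s))) => [sp|sn]|
  case: (boolP (is_positive (val t))) => [sp|sn]|case: (boolP (is_positive (val u))) => [sp|sn]].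
- by apply: Or31; exists (inl (exist _ s sp)).
- by apply: Or32; exists (inl (exist _ s sn)).
- by apply: Or32; exists (inr (exist _ t sp)).
- by apply: Or33; exists (inl (exist _ t sn)).
- by apply: Or33; exists (inr (exist _ u sp)).
- by apply: Or31; exists (inr (exist _ u sn)).
Qed.

Lemma union_edgeP (A : Type) (S T U : star_shape A) (f : leaf_function S T)
    (g : leaf_function T U) (x y : leaf3 S T U) :
  union_edge f g x y <->
  (exists2 l, x = in_ST U (dom_leaf l) & y = in_ST U (cod_leaf (f l))) \/
  (exists2 l, x = in_TU S (dom_leaf l) & y = in_TU S (cod_leaf (g l))).
Proof.
split.
  by case/orP => /existsP[l /andP[/eqP-> /eqP->]]; [left|right]; exists l.
by case=> -[l -> ->]; apply/orP; [left|right]; apply/existsP; exists l; rewrite !eqxx.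
Qed.

Lemma union_edge_fun (A : Type) (S T U : star_shape A) (f : leaf_function S T)
    (g : leaf_function T U) (x y z : leaf3 S T U) :
  union_edge f g x y -> union_edge f g x z -> y = z.
Proof.
move=> /union_edgeP[] [l -> ->] /union_edgeP[] [l' E ->].
- by move: E => [] /dom_leaf_inj ->.
- by case: (dom_ST_TU E).
- by case: (dom_ST_TU (esym E)).
- by move: E => /in_TU_inj /dom_leaf_inj ->.
Qed.

Lemma union_edge_terminal (A : Type) (S T U : star_shape A) (f : leaf_function S T)
    (g : leaf_function T U) (l : leaf_cod S U) (y : leaf3 S T U) :
  ~~ union_edge f g (in_SU T (cod_leaf l)) y.
Proof.
by apply/negP => /union_edgeP[] [l' E _]; [case: (cod_SU_dom_ST E)|case: (cod_SU_dom_TU E)].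
Qed.

Lemma union_edge_initial (A : Type) (S T U : star_shape A) (f : leaf_function S T)
    (g : leaf_function T U) (l : leaf_dom S U) (y : leaf3 S T U) :
  ~~ union_edge f g y (in_SU T (dom_leaf l)).
Proof.
by apply/negP => /union_edgeP[] [l' _ E]; [case: (dom_SU_cod_ST E)|case: (dom_SU_cod_TU E)].
Qed.

(** * The glued graph of [f] and [g] *)

Definition leaf3_vertex (A : Type) (S T U : star_shape A) (x : leaf3 S T U) :
    (vertex S + vertex T + vertex U)%type :=
  match x with inl (inl s) => inl (inl (val s)) | inl (inr t) => inl (inr (val t))
             | inr u => inr (val u) end.

Lemma leaf3_vertex_inj (A : Type) (S T U : star_shape A) : injective (@leaf3_vertex A S T U).
Proof. by case=> [[s|t]|u] [[s'|t']|u'] //= [/val_inj ->]. Qed.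

Definition glued_graph (A : Type) (S T U : star_shape A) (f : leaf_function S T)
    (g : leaf_function T U) (s1 : vertex S -> bool) (s2 : vertex U -> bool)
    (x y : vertex S + vertex T + vertex U) : Prop :=
  [\/ map_graph (fun u => inl (inl u)) (shape_edge true s1) x y,
      map_graph inr (shape_edge false s2) x y |
      exists u v, [/\ union_edge f g u v, x = leaf3_vertex u & y = leaf3_vertex v]].

Lemma glued_tree (A : Type) (S T U : star_shape A) (f : leaf_function S T)
    (g : leaf_function T U) (s1 : vertex S -> bool) (s2 : vertex U -> bool) :
  is_linking f -> is_linking g ->
  tree_on (glued_graph f g s1 s2) (fun x => forall v, x = inl (inr v) -> is_leaf v).
Proof.
move=> [_ /linking_treeP treef] [_ /linking_treeP treeg].
pose V := (vertex S + vertex T + vertex U)%type.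
pose aS (u : vertex S) : V := inl (inl u); pose aT (u : vertex T) : V := inl (inr u).
pose aU (u : vertex U) : V := inr u.
pose jTU (x : vertex T + vertex U) : V := match x with inl v => aT v | inr u => aU u end.
pose F := graphU (map_graph aS (shape_edge true s1))
  (fun x y => exists2 l, x = leaf3_vertex (in_ST U (dom_leaf l)) &
                         y = leaf3_vertex (in_ST U (cod_leaf (f l)))).
pose G := graphU (map_graph aU (shape_edge false s2))
  (fun x y => exists2 l, x = leaf3_vertex (in_TU S (dom_leaf l)) &
                         y = leaf3_vertex (in_TU S (cod_leaf (g l)))).
pose leafT (x : V) := exists2 u, is_leaf u & x = aT u.
pose DF := adjoin (image_of aS) leafT; pose DG := adjoin (image_of aU) leafT.
have jlS (l : leaf S + leaf T) : leaf3_vertex (in_ST U l) = inl (leaf_vertex l) by case: l.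
have jlU (l : leaf T + leaf U) : leaf3_vertex (in_TU S l) = jTU (leaf_vertex l) by case: l.
have DFl (l : leaf S + leaf T) : DF (leaf3_vertex (in_ST U l)).
  by case: l => l; [left; exists (val l)|right; exists (val l) => //; exact: (valP l)].
have DGl (l : leaf T + leaf U) : DG (leaf3_vertex (in_TU S l)).
  by case: l => l; [right; exists (val l) => //; exact: (valP l)|left; exists (val l)].
have: tree_on (graphU F G) (adjoin DF DG).
  (* [F] and [G] are the two linking graphs without the parse tree of [T], meeting in its leaves.
     [T] is the target of [f], hence [false] on the side of [F], and the source of [g], hence [true]
     on the side of [G]. *)
  refine (@every_gluable A T V false aT F G DF DG _ _ _ _ _ _ _ _).
  - by move=> u v [].
  - move=> x y [m|[l -> ->]]; first by have [? ?] := within_map m; split; left.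
    by split; exact: DFl.
  - move=> x y [m|[l -> ->]]; first by have [? ?] := within_map m; split; left.
    by split; exact: DGl.
  - by move=> u [[]//|[v ? [->]]].
  - by move=> u [[]//|[v ? [->]]].
  - move=> x [[u ->]|[u _ ->] _]; last by exists u.
    by case=> [[//]|[]].
  - move=> sw; apply: tree_eqv (tree_map (a := inl : vertex S + vertex T -> V) _ (treef s1 sw)).
    + move=> x y; split.
        move=> [u [v [+ -> ->]]].
        case=> [[u' [v' [e -> ->]]]|[u' [v' [e -> ->]]]|/graph_leaf_edgeP[l -> ->]].
        * by left; left; exists u', v'.
        * by right; exists u', v'.
        * by left; right; exists l; rewrite jlS.
      case=> [[[u [v [e -> ->]]]|[l -> ->]]|[u [v [e -> ->]]]].
      * by exists (inl u), (inl v); split=> //; apply: Or31; exists u, v.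
      * rewrite !jlS; do 2!eexists; split=> //; apply: Or33.
        by apply/graph_leaf_edgeP; exists l.
      * by exists (inr u), (inr v); split=> //; apply: Or32; exists u, v.
    + by move=> x [[[u ->]|[u _ ->]]|[u ->]]; [exists (inl u)|exists (inr u)|exists (inr u)].
    by move=> u v [].
  - move=> sw; apply: tree_eqv (tree_map (a := jTU) _ (treeg sw s2)).
    + move=> x y; split.
        move=> [u [v [+ -> ->]]].
        case=> [[u' [v' [e -> ->]]]|[u' [v' [e -> ->]]]|/graph_leaf_edgeP[l -> ->]].
        * by right; exists u', v'.
        * by left; left; exists u', v'.
        * by left; right; exists l; rewrite jlU.
      case=> [[[u [v [e -> ->]]]|[l -> ->]]|[u [v [e -> ->]]]].
      * by exists (inr u), (inr v); split=> //; apply: Or32; exists u, v.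
      * rewrite !jlU; do 2!eexists; split=> //; apply: Or33.
        by apply/graph_leaf_edgeP; exists l.
      * by exists (inl u), (inl v); split=> //; apply: Or31; exists u, v.
    + by move=> x [[[u ->]|[u _ ->]]|[u ->]]; [exists (inr u)|exists (inl u)|exists (inl u)].
    by move=> [u|u] [v|v] //= [->].
apply: tree_eqv => [x y|[[u|u]|u] leafu].
- split.
    case=> [[m|[l -> ->]]|[m|[l -> ->]]]; [exact: Or31|apply: Or33|exact: Or32|apply: Or33].
      by do 2!eexists; split=> //; apply/union_edgeP; left; exists l.
    by do 2!eexists; split=> //; apply/union_edgeP; right; exists l.
  case=> [m|m|[u [v [/union_edgeP[] [l -> ->] -> ->]]]].
  - by left; left.
  - by right; left.
  - by left; right; exists l.
  - by right; right; exists l.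
- by left; left; exists u.
- by left; right; exists u => //; apply: leafu.
- by right; left; exists u.
Qed.

(** * The ends of directed paths *)

Lemma union_edge_acyclic (A : Type) (S T U : star_shape A) (f : leaf_function S T)
    (g : leaf_function T U) : is_linking f -> is_linking g ->
  forall x y, union_edge f g x y -> ~~ connect (union_edge f g) y x.
Proof.
(* Leaf edges belong to the glued graph of every switching, so any one choice will do. *)
move=> lf lg; have [fK _] := glued_tree xpredT xpredT lf lg.
by apply: forest_acyclic (@leaf3_vertex_inj A S T U) _ fK => x y xy; apply: Or33; exists x, y.
Qed.

(** A path followed until it stops ends in [leaf_cod S U], every other leaf having an outgoing edge.
    [r] is also defined on the leaves of [T], as the contraction requires. *)
Lemma path_resolution (A : Type) (S T U : star_shape A) (f : leaf_function S T)
    (g : leaf_function T U) : is_linking f -> is_linking g ->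
  exists r : leaf3 S T U -> leaf_cod S U,
    forall x, connect (union_edge f g) x (in_SU T (cod_leaf (r x))).
Proof.
move=> lf lg.
suff /choice[r rP] x : exists l, connect (union_edge f g) x (in_SU T (cod_leaf l)) by exists r.
 have [t xt tP] := terminal_reach (union_edge_acyclic lf lg) x.
case: (leaf3_source t) => [[l tE]|[l tE]|[l tE]]; first by exists l; rewrite -tE.
  have : union_edge f g t (in_ST U (cod_leaf (f l))) by apply/union_edgeP; left; exists l.
  by rewrite (negbTE (tP _)).
have : union_edge f g t (in_TU S (cod_leaf (g l))) by apply/union_edgeP; right; exists l.
by rewrite (negbTE (tP _)).
Qed.

Lemma path_composite_unique (A : Type) (S T U : star_shape A) (f : leaf_function S T)
    (g : leaf_function T U) (x : leaf3 S T U) (l l' : leaf_cod S U) :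
  connect (union_edge f g) x (in_SU T (cod_leaf l)) ->
  connect (union_edge f g) x (in_SU T (cod_leaf l')) -> l = l'.
Proof.
move=> xl xl'; apply: cod_leaf_inj; apply: (@in_SU_inj A S T U).
exact: (terminal_unique (@union_edge_fun _ _ _ _ f g) (union_edge_terminal f g l)
  (union_edge_terminal f g l')) xl xl'.
Qed.

Lemma dom_cod_leaf (A : Type) (S T : star_shape A) (l : leaf_dom S T) (l' : leaf_cod S T) :
  dom_leaf l <> cod_leaf l'.
Proof.
by case: l l' => [[k p]|[k p]] [[k' q]|[k' q]] //= -[e]; move: p q; rewrite /= e;
  case: (is_positive _).
Qed.

Lemma dom_or_cod_leaf (A : Type) (S T : star_shape A) (l : (leaf S + leaf T)%type) :
  (exists k : leaf_dom S T, l = dom_leaf k) \/ (exists k : leaf_cod S T, l = cod_leaf k).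
Proof.
case: l => l; have [lp|ln] := boolP (is_positive (val l)).
- by left; exists (inl (exist _ l lp)).
- by right; exists (inl (exist _ l ln)).
- by right; exists (inr (exist _ l lp)).
- by left; exists (inr (exist _ l ln)).
Qed.

(** * Bijectivity on each generator *)

Definition has_atom3 (A : Type) (S T U : star_shape A) (x : atom A) (l : leaf3 S T U) : Prop :=
  match l with
  | inl (inl s) => label (val s) = LAtom x
  | inl (inr t) => label (val t) = LAtom x
  | inr u => label (val u) = LAtom x
  end.

(* Paths are traversed backwards: a leaf may have several predecessors, but exactly one
   with the same generator. *)
Lemma composite_bij (A : Type) (S T U : star_shape A) (f : leaf_function S T)
    (g : leaf_function T U) (h : leaf_function S U) (a : A) :
  is_linking f -> is_linking g ->
  (forall l, path_composite f g l (h l)) ->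
  set_bij [set l : leaf_dom S U | has_atom (Gen a) (dom_leaf l)]%classic
          [set l : leaf_cod S U | has_atom (Gen a) (cod_leaf l)]%classic h.
Proof.
move=> lf lg hP; have [funf injf surjf] := lf.1 a; have [fung injg surjg] := lg.1 a.
set e := union_edge f g in hP *; pose lab := @has_atom3 A S T U (Gen a).
have labST l : lab (in_ST U l) <-> has_atom (Gen a) l by case: l.
have labTU l : lab (in_TU S l) <-> has_atom (Gen a) l by case: l.
have labSU l : lab (in_SU T l) <-> has_atom (Gen a) l by case: l.
have labe x y : e x y -> lab x -> lab y.
  by move=> /union_edgeP[] [l -> ->]; [move/labST/funf/labST|move/labTU/fung/labTU].
have inje x y z : e y x -> e z x -> lab y -> lab z -> y = z.
  move=> /union_edgeP[] [l -> ->] /union_edgeP[] [l' -> E].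
  - move: E => [] /cod_leaf_inj E /labST la /labST la'.
    by rewrite (injf l l') //; exact/mem_set.
  - by case: (cod_ST_TU E).
  - by case: (cod_ST_TU (esym E)).
  - move: E => /in_TU_inj /cod_leaf_inj E /labTU la /labTU la'.
    by rewrite (injg l l') //; exact/mem_set.
(* Backward steps to a source labelled [a]; by [inje] they form a partial function, to which the
   lemmas on terminal vertices apply. *)
pose r x y := e y x && `[< lab y >].
have rP x y : r x y <-> e y x /\ lab y.
  by split=> [/andP[? /asboolP]|[? ?]]; [|apply/andP; split=> //; apply/asboolP].
have funr x y z : r x y -> r x z -> y = z.
  by move=> /rP[xy ly] /rP[xz lz]; exact: inje xy xz ly lz.
have rev_connect x y : connect e x y -> lab x -> connect r y x.
  move=> /connectP[p]; elim: p x => [|z p IH] x /=; first by move=> _ ->.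
  move=> /andP[xz pz] yE lx; apply: connect_trans (IH z pz yE (labe _ _ xz lx)) _.
  by apply: connect1; apply/rP.
have connect_rev x y : connect r x y -> lab x -> connect e y x /\ lab y.
  move=> /connectP[p]; elim: p x => [|z p IH] x /=; first by move=> _ ->.
  move=> /andP[/rP[zx lz] pz] yE lx; have [yz ly] := IH z pz yE lz.
  by split=> //; apply: connect_trans yz _; exact: connect1.
have initial l y : ~~ r (in_SU T (dom_leaf l)) y.
  by apply/negP => /rP[yl _]; move: (union_edge_initial f g l y); rewrite -/e yl.
have lab_connect x y : connect e x y -> lab x -> lab y.
  move=> /connectP[p]; elim: p x => [|z p IH] x /=; first by move=> _ ->.
  by move=> /andP[xz pz] yE /(labe _ _ xz); apply: IH.
have hlab l : has_atom (Gen a) (dom_leaf l) -> has_atom (Gen a) (cod_leaf (h l)).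
  by move/labSU/(lab_connect _ _ (hP l))/labSU.
split=> //.
  move=> l l' /set_mem /labSU la /set_mem /labSU la' hE.
  apply: dom_leaf_inj; apply: (@in_SU_inj A S T U).
  have c := rev_connect _ _ (hP l) la; have := rev_connect _ _ (hP l') la'; rewrite -hE => c'.
  exact: (terminal_unique funr (initial l) (initial l') c c').
move=> l' /labSU la'.
have acyc x y : r x y -> ~~ connect r y x.
  move=> /rP[yx ly]; apply/negP => /connect_rev /(_ ly) [xy _].
  by move: (union_edge_acyclic lf lg yx); rewrite xy.
(* Going backwards from [l'] stops at some [t] labelled [a]. Surjectivity of [f] and [g] on such
   leaves would continue the walk from their codomains, so [t] is in [leaf_dom S U]. *)
have [t lt tP] := terminal_reach acyc (in_SU T (cod_leaf l')).
have [tl tlab] := connect_rev _ _ lt la'.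
case: (leaf3_target t) => [[l tE]|[l tE]|[l tE]].
- exists l; first by apply/labSU; rewrite -tE.
  by apply: path_composite_unique (hP l) _; rewrite -tE.
- have [k ka kE] := surjf l (proj1 (labST _) (eq_ind _ lab tlab _ tE)).
  have : r t (in_ST U (dom_leaf k)).
    by apply/rP; split; [apply/union_edgeP; left; exists k; rewrite ?kE|apply/labST].
  by rewrite (negbTE (tP _)).
- have [k ka kE] := surjg l (proj1 (labTU _) (eq_ind _ lab tlab _ tE)).
  have : r t (in_TU S (dom_leaf k)).
    by apply/rP; split; [apply/union_edgeP; right; exists k; rewrite ?kE|apply/labTU].
  by rewrite (negbTE (tP _)).
Qed.

(** * The tree condition for the composite *)

(* Contracting every leaf of [T] to the end of its directed path turns the glued graph
   into the graph of the composite. *)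
Lemma composite_tree (A : Type) (S T U : star_shape A) (f : leaf_function S T)
    (g : leaf_function T U) (r : leaf3 S T U -> leaf_cod S U) (h : leaf_function S U)
    (s1 : vertex S -> bool) (s2 : vertex U -> bool) :
  is_linking f -> is_linking g ->
  (forall x, connect (union_edge f g) x (in_SU T (cod_leaf (r x)))) ->
  (forall l, h l = r (in_SU T (dom_leaf l))) ->
  tree_on (linking_graph h s1 s2) (fun=> True).
Proof.
move=> lf lg rP hE; have [fK cK] := glued_tree s1 s2 lf lg; set e := union_edge f g in rP *.
pose j (x : graph_vertex S U) : vertex S + vertex T + vertex U :=
  match x with inl u => inl (inl u) | inr u => inr u end.
have injj : injective j by case=> [u|u] [v|v] //= [->].
have jl (l : leaf S + leaf U) : j (leaf_vertex l) = leaf3_vertex (in_SU T l) by case: l.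
pose K := glued_graph f g s1 s2.
pose args x y := map_graph inl (shape_edge true s1) x y \/ map_graph inr (shape_edge false s2) x y.
have nonleaf x y (w : leaf3 S T U) : args x y -> j x <> leaf3_vertex w.
  case=> -[u [v [[i /argument_edge_nonleaf nl _] -> _]]]; case: w => [[w|w]|w] //= [uw];
    by move: nl; rewrite uw (valP w).
have KS x y : args x y -> K (j x) (j y).
  by case=> -[u [v [k -> ->]]]; [apply: Or31|apply: Or32]; exists u, v.
have Ke x y : e x y -> K (leaf3_vertex x) (leaf3_vertex y) by move=> xy; apply: Or33; exists x, y.
have hP l : connect e (in_SU T (dom_leaf l)) (in_SU T (cod_leaf (h l))) by rewrite hE.
have noin l u : ~~ e u (in_SU T (dom_leaf l)) := union_edge_initial f g l u.
split.
  move=> x y; suff cutargs : args x y -> exists2 B, B x <> B y &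
      uncut (fun x' y' => linking_graph h s1 s2 x' y' /\ (x', y') <> (x, y)) B.
    case=> [m|m|/graph_leaf_edgeP[l -> ->]]; [by apply: cutargs; left|by apply: cutargs; right|].
    (* A leaf edge of the composite is cut at the first edge of its path. No edge enters the
       starting leaf, so neither the rest of this path nor a path from another leaf uses that first
       edge. *)
    have [E|[z lz zh]] := connect_step (hP l).
      by move/in_SU_inj: E => /dom_cod_leaf.
    have [B Blz uB] := fK _ _ (Ke _ _ lz).
    have uBe u v : e u v -> u <> in_SU T (dom_leaf l) -> B (leaf3_vertex u) = B (leaf3_vertex v).
      by move=> uv ul; apply: uB; split; [exact: Ke|move=> [/leaf3_vertex_inj]].
    have Bto u v : u <> in_SU T (dom_leaf l) -> connect e u v ->
        B (leaf3_vertex u) = B (leaf3_vertex v).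
      exact: (connect_avoid (c := B \o @leaf3_vertex A S T U) (noin l) uBe).
    exists (B \o j) => /=.
      rewrite !jl -(Bto _ _ _ zh) //.
      by move=> zl; move: (noin l (in_SU T (dom_leaf l))); rewrite -{2}zl lz.
    have uBa x' y' : args x' y' -> B (j x') = B (j y').
      by move=> m; apply: uB; split; [exact: KS|move=> [/(nonleaf _ _ _ m)]].
    move=> x' y' [[m|m|/graph_leaf_edgeP[l0 -> ->]] ne] /=;
      [by apply: uBa; left|by apply: uBa; right|].
    rewrite !jl; apply: Bto => // /in_SU_inj /dom_leaf_inj ll; apply: ne.
    by rewrite ll.
  (* For an argument edge, the cut of the glued graph restricts: all leaf edges respect it, hence so
     do whole paths. *)
  move=> xy; have [B Bxy uB] := fK _ _ (KS _ _ xy); exists (B \o j) => //=.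
  have uBa x' y' : args x' y' -> (x', y') <> (x, y) -> B (j x') = B (j y').
    by move=> m ne; apply: uB; split; [exact: KS|move=> [/injj ex /injj ey]; rewrite ex ey in ne].
  move=> x' y' [[m|m|/graph_leaf_edgeP[l -> ->]] ne] /=;
    [by apply: uBa ne; left|by apply: uBa ne; right|].
  rewrite !jl; apply: (connect_const (c := B \o @leaf3_vertex A S T U) _ (hP l)) => u v uv /=.
  by apply: uB; split; [exact: Ke|move=> [xu _]; case: (nonleaf _ _ u xy)].
move=> B uB x y _ _.
(* [B] is extended to each leaf of [T] by its value at the end of the path from there. Inner
   vertices of [T], which no edge of the glued graph meets, get [true]. *)
pose c (z : leaf3 S T U) := B (leaf_vertex (cod_leaf (r z))).
pose B' (v : vertex S + vertex T + vertex U) := match v with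
  | inl (inl u) => B (inl u)
  | inl (inr t) => if insub t is Some l then c (inl (inr l)) else true
  | inr u => B (inr u) end.
have B'j v : B' (j v) = B v by case: v.
(* On [S] and [U] the two descriptions agree: a leaf in [leaf_dom S U] is joined by [h] to the end
   of its path, and a leaf in [leaf_cod S U] is its own end. *)
have B'SU (l : leaf S + leaf U) : B' (leaf3_vertex (in_SU T l)) = c (in_SU T l).
  rewrite -jl B'j /c; case: (dom_or_cod_leaf l) => -[k ->].
    by rewrite -hE; apply: uB; apply: Or33; apply/graph_leaf_edgeP; exists k.
  congr (B (leaf_vertex (cod_leaf _))).
  exact: path_composite_unique (connect0 _ _) (rP _).
have B'c z : B' (leaf3_vertex z) = c z.
  case: z => [[s|t]|u]; [exact: (B'SU (inl s))| |exact: (B'SU (inr u))].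
  by rewrite /B' /= valK.
rewrite -B'j -(B'j y); apply: cK; [|by case: x|by case: y].
move=> u v [[u' [v' [m -> ->]]]|[u' [v' [m -> ->]]]|[u' [v' [uv -> ->]]]].
- by apply: uB; apply: Or31; exists u', v'.
- by apply: uB; apply: Or32; exists u', v'.
rewrite !B'c /c; congr (B (leaf_vertex (cod_leaf _))).
apply: path_composite_unique (rP u') _; apply: connect_trans (rP v'); exact: connect1.
Qed.

(* [h] is the path composite f;g, which is thereby asserted to be total. *)
Theorem proposition3 (A : Type) (S T U : star_shape A)
    (f : leaf_function S T) (g : leaf_function T U)
    (f_linking : is_linking f) (g_linking : is_linking g) :
  exists h : leaf_function S U,
    (forall (l : leaf_dom S U) (l' : leaf_cod S U),
       path_composite f g l l' <-> h l = l') /\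
    is_linking h.
Proof.
have [r rP] := path_resolution f_linking g_linking.
pose h l := r (in_SU T (dom_leaf l)); exists h; split.
  move=> l l'; split=> [c|<-]; last exact: rP.
  exact: path_composite_unique (rP _) c.
split; first by move=> a; apply: (composite_bij a f_linking g_linking) => l; exact: rP.
apply/linking_treeP => s1 s2.
exact: (composite_tree s1 s2 f_linking g_linking rP).
Qed.
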